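(* The subshift $(\mathbb{X},\sigma)$ constructed in the context has the following properties: (1) if $M\subset\mathbb{X}$ is minimal, then either $M=\{0^\infty\}$ or $M=M_n$ for some $n\ge1$; (2) $(\mathbb{X},\sigma)$ is weakly mixing; (3) $(K(\mathbb{X}),\sigma_K)$ has dense periodic points.
   Context: Symbolic notation. $\Sigma_2=\{0,1\}^{\mathbb{N}}$ ($\mathbb{N}=\{1,2,\dots\}$) with the product topology, $\sigma(x)_n=x_{n+1}$ is the shift. A subshift is a non-empty closed $\sigma$-invariant subset of $\Sigma_2$. For a finite word $w$ over $\{0,1\}$, $|w|$ is its length and $|w|_1$ the number of occurrences of the symbol $1$; $uv$ denotes concatenation, $u^m$ the $m$-fold concatenation, and $u^\infty$ the infinite concatenation. $L_n(X)$ is the set of words of length $n$ appearing in elements of $X\subset\Sigma_2$. The subshift $X(w,\varepsilon)$. Let $\varepsilon>0$ and let $w$ be a non-empty word with at least one occurrence of $1$. Put $s=|w|$ and choose an integer $t>3s$ with $2s/(s+t)<\varepsilon$ and $2s/t<|w|_1/|w|$. Put $$u_0=w0^tw0^{t+1}w0^t,\quad v_0=w0^{3t+2s+1},\quad u_1=u_0v_0u_0,\quad v_1=u_0v_0,$$ and for $k\ge1$: $u_{k+1}=u_kv_ku_ku_k$, $v_{k+1}=u_kv_kv_ku_k$. Let $z\in\Sigma_2$ be the sequence having every $u_k$ as a prefix, and $X(w,\varepsilon)=\overline{\{\sigma^m z:m\ge0\}}$. The subshift $\mathbb{X}$. Let $\varepsilon_n=9^{-n}$ for $n\ge1$, $w_1=010^{10}$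 (the word $0,1$ followed by ten $0$'s) and $M_1=X(w_1,\varepsilon_1)$. Inductively, given $M_1,\dots,M_n$, enumerate $L_n(\bigcup_{i=1}^nM_i)=\{u_1,\dots,u_{s_n}\}$, put $$w_{n+1}=u_10^{n9^n}u_20^{n9^n}\cdots u_{s_n}0^{n9^n}$$ and $M_{n+1}=X(w_{n+1},\varepsilon_{n+1})$. Finally $\mathbb{X}=\overline{\bigcup_{n=1}^\infty M_n}$. Dynamical notions, for a continuous surjective map $T$ of a compact metric space $X$. A minimal set $M\subset X$ is a non-empty closed $T$-invariant set in which every point has dense forward orbit. $(X,T)$ is transitive if for all non-empty open $U,V$ the set $\{n\ge0:U\cap T^{-n}V\ne\emptyset\}$ is infinite, and weakly mixing if $(X\times X,T\times T)$ is transitive. A point $x$ is periodic if $T^nx=x$ for some $n\in\mathbb{N}$. $K(X)$ is the set of non-empty closed subsets of $X$ with the Hausdorff metric and $T_K(A)=T(A)$. *)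

(* Defs.v *)
From HB Require Import structures.
From mathcomp Require Import all_boot all_order all_algebra.
From mathcomp Require Import all_classical all_reals.
From mathcomp Require Import topology cantor.
From mathcomp Require Import zify.

Set Implicit Arguments.
Unset Strict Implicit.
Unset Printing Implicit Defensive.

Import Order.TTheory GRing.Theory Num.Theory.

Local Open Scope classical_set_scope.
Local Open Scope ring_scope.

(* A subsystem is given by a map f of an ambient topological space together
   with a subset X; its topology is the one induced on X. *)
Section Dynamics.
Context {T : topologicalType}.
Implicit Types (f : T -> T) (X M : set T).

Definition forward_orbit f (x : T) : set T := range (fun n => iter n f x).

Definition minimal_set f X M :=
  [/\ M `<=` X, M !=set0, closed M, f @` M `<=` M &
      forall x, M x -> M `<=` closure (forward_orbit f x)].

Definition transitive_system f X :=
  forall U V : set T, open U -> open V ->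
    (X `&` U) !=set0 -> (X `&` V) !=set0 ->
    infinite_set
      [set n : nat | ((X `&` U) `&` iter n f @^-1` (X `&` V)) !=set0].

End Dynamics.

Definition weakly_mixing {T : topologicalType} (f : T -> T) (X : set T) :=
  transitive_system (fun p : T * T => (f p.1, f p.2)) (X `*` X).

Definition periodic_point {S : Type} (f : S -> S) (x : S) :=
  exists2 n, (0 < n)%N & iter n f x = x.

(* Density of the periodic points of (X, f) for a distance dist on X. *)
Definition dense_periodic_points {R : realType} {S : Type}
    (dist : S -> S -> R) (X : set S) (f : S -> S) :=
  forall x, X x -> forall e : R, 0 < e ->
    exists y, [/\ X y, periodic_point f y & dist x y < e].

(* d is a metric on T inducing the topology of T. *)
Definition compatible_metric {R : realType} {T : topologicalType}
    (d : T -> T -> R) :=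
  [/\ forall x y, d x y = 0 <-> x = y,
      forall x y, d x y = d y x,
      forall x y z, d x z <= d x y + d y z &
      forall x (A : set T),
        nbhs x A <-> exists2 e : R, 0 < e & [set y | d x y < e] `<=` A].

(* Members are closed in T, which for closed X is the same as closed in X. *)
Definition hyperspace {T : topologicalType} (X : set T) : set (set T) :=
  [set A | [/\ A !=set0, closed A & A `<=` X]].

Definition hausdorff_dist {R : realType} {T : Type}
    (d : T -> T -> R) (A B : set T) : R :=
  Num.max (sup [set inf [set d a b | b in B] | a in A])
          (sup [set inf [set d a b | a in A] | b in B]).

(* Sequences are indexed from 0 instead of 1; the symbols 0 and 1 are false and
   true. *)
Definition shift (x : cantor_space) : cantor_space := fun n => x n.+1.

Definition zero_seq : cantor_space := fun=> false.

Definition language (n : nat) (X : set cantor_space) : set (seq bool) :=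
  [set v | exists2 x, X x & exists m, v = mkseq (fun i => x (m + i)%N) n].

Definition zeros (m : nat) : seq bool := nseq m false.

Section Blocks.
Variables (w : seq bool) (t : nat).
Let s := size w.

Fixpoint uv (k : nat) : seq bool * seq bool :=
  match k with
  | 0%N => (w ++ zeros t ++ w ++ zeros t.+1 ++ w ++ zeros t,
          w ++ zeros (3 * t + 2 * s + 1))
  | k'.+1 => let: (u, v) := uv k' in
             if k' == 0%N then (u ++ v ++ u, u ++ v)
             else (u ++ v ++ u ++ u, u ++ v ++ v ++ u)
  end.

Definition u_ k := (uv k).1.
Definition v_ k := (uv k).2.

(* Well defined by z_prefix, since k < size (u_ k). *)
Definition z_ : cantor_space := fun i => nth false (u_ i) i.

Lemma u_prefix k : exists r, u_ k.+1 = u_ k ++ r.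
Proof.
rewrite /u_ /=; case: (uv k) => a b.
by case: ifP => _ /=; eexists; reflexivity.
Qed.

Lemma size_u_gt k : (k < size (u_ k))%N.
Proof.
have h j : (0 < size (v_ j))%N /\ (j < size (u_ j))%N.
  elim: j => [|j []]; rewrite /u_ /v_ /=.
    by rewrite /zeros !size_cat !size_nseq /=; split; lia.
  case: (uv j) => a b /= hb ha.
  by case: ifP => _ /=; rewrite !size_cat; split; lia.
by case: (h k).
Qed.

Lemma z_prefix k i : (i < size (u_ k))%N -> z_ i = nth false (u_ k) i.
Proof.
have mono j m : exists r, u_ (m + j) = u_ j ++ r.
  elim: m => [|m [r hr]]; first by exists [::]; rewrite cats0.
  by have [q hq] := u_prefix (m + j); exists (r ++ q); rewrite addSn hq hr catA.
move=> ik; rewrite /z_; have [le_ki|/ltnW le_ik] := leqP k i.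
- by have [r] := mono k (i - k)%N; rewrite subnK // => ->; rewrite nth_cat ik.
- have [r] := mono i (k - i)%N; rewrite subnK // => ->.
  by rewrite nth_cat size_u_gt.
Qed.

End Blocks.

(* The requirements on t in the definition of X(w, eps).  The last one fails
   unless w contains a 1, because x / 0 = 0. *)
Definition admissible {R : realType} (w : seq bool) (eps : R) (t : nat) :=
  let s := size w in
  [/\ (3 * s < t)%N,
      (2 * s)%:R / (s + t)%:R < eps &
      (2 * s)%:R / t%:R < (count_mem true w)%:R / s%:R :> R].

(* A is the subshift X(w, eps), for some admissible choice of t. *)
Definition is_X {R : realType} (w : seq bool) (eps : R)
    (A : set cantor_space) :=
  exists2 t, admissible w eps t & A = closure (forward_orbit shift (z_ w t)).

(* w_n and M_n are indexed by n >= 1; w 0 and M 0 are irrelevant.  The list e is an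
   enumeration of L_n(M_1 U ... U M_n). *)
Definition is_construction (R : realType) (w : nat -> seq bool)
    (M : nat -> set cantor_space) :=
  [/\ w 1%N = [:: false; true] ++ zeros 10,
      forall n, (1 <= n)%N -> is_X (w n) ((9%:R : R) ^- n) (M n) &
      forall n, (1 <= n)%N ->
        exists e : seq (seq bool),
          [/\ uniq e,
              forall v : seq bool, v \in e <->
                language n (\bigcup_(i in [set i | (1 <= i <= n)%N]) M i) v &
              w n.+1 = flatten [seq v ++ zeros (n * 9 ^ n) | v <- e]]].

Definition bbX (M : nat -> set cantor_space) : set cantor_space :=
  closure (\bigcup_(n in [set n | (1 <= n)%N]) M n).

(* Main.v *)
Require Import Defs.
From mathcomp Require Import all_boot all_order all_algebra.
From mathcomp Require Import all_classical all_reals.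
From mathcomp Require Import topology cantor.
From mathcomp Require Import zify lra.

(* Let z_n be the sequence with M_n = closure of the orbit of z_n, and let
   s = |w_n|, t = t_n.  Every word of M_1, M_2, ... occurs in w_n for all large
   n, so only the way w_n recurs in z_n matters.

   Minimal sets.  For k >= 1 both u_k and v_k start with u_{k-1}, so z_n is uniformly
   recurrent and M_n is minimal.  Let x belong to a minimal set N.  If x has
   arbitrarily long runs of 0, then N = {0^oo}.  If the runs have length at most
   B and n > B + 2, then w_n consists of words of M_1, ..., M_{n-1} separated by
   runs of 0 longer than B; so a factor of x lying in M_n is, up to zeros at its
   two ends, a factor of some M_j with j < n.  Descending, all factors of the
   (B+1)-st shift of x occur in M_1, ..., M_{B+2}; by pigeonhole this shift lies in
   one of them, which is then N.

   Weak mixing.  In u_0 the word w_n occurs at distances s + t and s + t + 1.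
   Hence a gap m between two words a, c inside w_n yields the gaps m + s + t and
   m + s + t + 1 inside w_k for large k, and by induction the set of gaps
   between a and c contains arbitrarily long intervals.  For four words that all
   occur in w_n this, applied to a = c = w_n, gives a common gap.

   Periodic points.  u_0 and v_0 have the same length L and both start with w_n,
   so w_n occurs in z_n at all multiples of L: every cylinder meeting the subshift
   contains a nonempty closed set invariant under the L-th power of the shift. *)

Import Order.TTheory GRing.Theory Num.Theory.

Local Open Scope classical_set_scope.

(** * Cylinders, and the shift on the Cantor space *)

Definition cylinder (x : cantor_space) (K : nat) : set cantor_space :=
  [set y | forall i, (i < K)%N -> y i = x i].

Lemma nbhs_cylinder x K : nbhs x (cylinder x K).
Proof.
elim: K => [|K IH]; first by apply: filterS filterT => y _ i.
have h : nbhs x [set y : cantor_space | y K = x K].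
  have := @proj_continuous nat (fun=> bool) K x.
  move=> /(_ [set b | b = x K]); apply.
  by rewrite nbhs_principalE; apply/principal_filterP.
apply: filterS2 IH h => y h1 h2 i.
by rewrite ltnS leq_eqVlt => /orP[/eqP->//|]; exact: h1.
Qed.

Lemma cylinder_sub_nbhs x A : nbhs x A -> exists K, cylinder x K `<=` A.
Proof.
pose F : set_system cantor_space := filter_from [set: nat] (cylinder x).
have FF : Filter F.
  apply: filter_from_filter; first by exists 0%N.
  move=> i j _ _; exists (maxn i j) => // y hy; split=> k hk; apply: hy; lia.
suff : F --> x by move=> h /h [K _ hK]; exists K.
(* The product topology is the supremum of the topologies pulled back along the coordinates, so
   convergence is checked one coordinate at a time; a cylinder of length [i.+1] fixes coordinate
   [i]. *)
apply/cvg_sup => i U [V] [[W] oW <-] WfN WU.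
exists i.+1 => // y hy; apply: WU; rewrite /= /proj /= hy //.
Qed.

Lemma closure_cylinderP (A : set cantor_space) x :
  closure A x <-> forall K, exists2 y, A y & cylinder x K y.
Proof.
split=> [h K|h B /cylinder_sub_nbhs[K hK]].
  by have [y [Ay hy]] := h _ (nbhs_cylinder x K); exists y.
by have [y Ay hy] := h K; exists y; split => //; exact: hK.
Qed.

Lemma iter_shift n x i : iter n shift x i = x (n + i)%N.
Proof. by elim: n i => //= n IH i; rewrite /shift /= IH addnS. Qed.

Lemma shift_continuous n : continuous (iter n shift).
Proof.
move=> x A /cylinder_sub_nbhs[K hK].
apply: filterS (nbhs_cylinder x (n + K)) => y hy; apply: hK => i ik.
by rewrite !iter_shift hy // ltn_add2l.
Qed.

Lemma closed_cantor_compact {A : set cantor_space} : closed A -> compact A.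
Proof.
by move=> cA; apply: subclosed_compact cantor_space_compact _.
Qed.

Lemma closed_image_shift n {A : set cantor_space} :
  closed A -> closed (iter n shift @` A).
Proof.
move=> /closed_cantor_compact cA; apply: compact_closed.
  exact: cantor_space_hausdorff.
apply: continuous_compact cA; apply: continuous_subspaceT; exact: shift_continuous.
Qed.

Lemma iter_image_shift n (A : set cantor_space) :
  iter n (fun B => shift @` B) A = iter n shift @` A.
Proof.
by elim: n => [|n IH] /=; rewrite ?image_id // IH -image_comp.
Qed.

(** * Occurrences of words in sequences *)

Definition occurs (x : nat -> bool) (p : nat) (c : seq bool) :=
  forall i, (i < size c)%N -> x (p + i)%N = nth false c i.

Lemma occurs_cat {x p a b} :
  occurs x p (a ++ b) <-> occurs x p a /\ occurs x (p + size a)%N b.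
Proof.
split=> [h|[ha hb] i].
  split=> i hi.
    by rewrite h ?size_cat ?nth_cat ?hi //; lia.
  by rewrite -addnA h ?size_cat ?nth_cat; [rewrite ifF; [congr nth|]|]; lia.
rewrite size_cat nth_cat => hi; case: ifPn => h; first exact: ha.
by rewrite -hb; [congr x|]; lia.
Qed.

Lemma occurs_infix {x p} {pre c post : seq bool} :
  occurs x p (pre ++ c ++ post) -> occurs x (p + size pre) c.
Proof. by move=> /occurs_cat[_ /occurs_cat[]]. Qed.

Lemma occurs_mkseq x p n : occurs x p (mkseq (fun i => x (p + i)%N) n).
Proof. by move=> i; rewrite size_mkseq => hi; rewrite nth_mkseq. Qed.

Lemma mkseq_occurs {x p c} :
  occurs x p c -> c = mkseq (fun i => x (p + i)%N) (size c).
Proof.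
move=> h; apply: (@eq_from_nth _ false); first by rewrite size_mkseq.
by move=> i hi; rewrite nth_mkseq // h.
Qed.

Lemma occurs_eq {x y p q c} :
  (forall i, (i < size c)%N -> x (p + i)%N = y (q + i)%N) ->
  occurs x p c -> occurs y q c.
Proof. by move=> e h i hi; rewrite -e // h. Qed.

(** * The blocks [u k], [v k] and recurrence in [z] *)

Section Substitution.
Variables (w : seq bool) (t : nat).
Local Notation u k := (u_ w t k).
Local Notation v k := (v_ w t k).
Local Notation z := (z_ w t).

Lemma u0E : u 0 = w ++ zeros t ++ w ++ zeros t.+1 ++ w ++ zeros t.
Proof. by []. Qed.

Lemma v0E : v 0 = w ++ zeros (3 * t + 2 * size w + 1).
Proof. by []. Qed.

Lemma u1E : u 1 = u 0 ++ v 0 ++ u 0.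
Proof. by []. Qed.

Lemma v1E : v 1 = u 0 ++ v 0.
Proof. by []. Qed.

Lemma uvSSE k : uv w t k.+2 = let: (a, b) := uv w t k.+1 in
  (a ++ b ++ a ++ a, a ++ b ++ b ++ a).
Proof. by []. Qed.

Lemma uSSE k : u k.+2 = u k.+1 ++ v k.+1 ++ u k.+1 ++ u k.+1.
Proof.
by rewrite /u_ /v_ (uvSSE k); case: (uv w t k.+1).
Qed.

Lemma vSSE k : v k.+2 = u k.+1 ++ v k.+1 ++ v k.+1 ++ u k.+1.
Proof.
by rewrite /u_ /v_ (uvSSE k); case: (uv w t k.+1).
Qed.

Lemma z_u k : occurs z 0 (u k).
Proof. by move=> i hi; rewrite add0n; exact: z_prefix. Qed.

(** The prefix [u k] of [z] is longer than [k], so for [k = p + size c] it covers the occurrence. *)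
Lemma occurs_z_infix {p c} : occurs z p c -> infix c (u (p + size c)).
Proof.
move=> h; set k := (p + size c)%N.
have hk : (k < size (u k))%N by exact: size_u_gt.
apply/infixP; exists (take p (u k)), (drop (p + size c) (u k)).
rewrite -{1}(cat_take_drop p (u k)); congr cat.
rewrite -{1}(cat_take_drop (size c) (drop p (u k))) drop_drop addnC; congr cat.
apply: (@eq_from_nth _ false).
  by rewrite size_take size_drop; case: ifP => //; lia.
move=> i; rewrite size_take size_drop => hi.
have ic : (i < size c)%N by move: hi; case: ifP => //; lia.
by rewrite nth_take // nth_drop -h // (@z_prefix w t k) //; lia.
Qed.

(** Parses long prefixes of [z] into blocks of level [k]; recurrence in [z] then becomes an
    induction over a list of two kinds of blocks. *)
Lemma uv_flatten k m :
  (exists2 bs : seq (seq bool),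
     all (mem [:: u k; v k]) bs & u (m + k) = flatten bs) /\
  (exists2 bs : seq (seq bool),
     all (mem [:: u k; v k]) bs & v (m + k) = flatten bs).
Proof.
elim: m => [|m [[bs hb eb] [cs hc ec]]].
  by split; [exists [:: u k]|exists [:: v k]];
    rewrite /= ?cats0 ?inE ?eqxx ?orbT.
rewrite addSn; case E : (m + k)%N => [|l]; rewrite E in eb ec.
  by rewrite u1E v1E; split; [exists (bs ++ cs ++ bs)|exists (bs ++ cs)];
    rewrite ?all_cat ?hb ?hc // ?flatten_cat ?eb ?ec.
by rewrite uSSE vSSE; split;
    [exists (bs ++ cs ++ bs ++ bs)|exists (bs ++ cs ++ cs ++ bs)];
    rewrite ?all_cat ?hb ?hc // ?flatten_cat ?eb ?ec.
Qed.

Lemma size_u0 : size (u 0) = (3 * size w + 3 * t + 1)%N.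
Proof. by rewrite u0E /zeros !size_cat !size_nseq; lia. Qed.

Lemma size_v0 : size (v 0) = size (u 0).
Proof. by rewrite size_u0 v0E /zeros !size_cat !size_nseq; lia. Qed.

(* All level-0 blocks have the same length and start with w. *)
Lemma z_periodic j : occurs z (j * size (u 0)) w.
Proof.
set L := size (u 0); have L0 : (0 < L)%N by exact: (size_u_gt w t 0).
have [[bs hb eb] _] := uv_flatten 0 (j * L); rewrite addn0 in eb.
have szb : (j < size bs)%N.
  have := size_u_gt w t (j * L); rewrite eb size_flatten.
  suff -> : sumn (shape bs) = (size bs * L)%N by rewrite ltn_mul2r => /andP[].
  elim: bs hb {eb} => //= b bs IH /andP[hb /IH ->].
  by move: hb; rewrite !inE => /orP[]/eqP->; rewrite ?size_v0 mulSn.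
have := z_u (j * L); rewrite {}eb.
suff H i : occurs z i (flatten bs) -> occurs z (i + j * L) w by exact: H.
elim: j bs i hb szb => [|j IH] [|b bs] i //= /andP[hb hbs] szb.
  rewrite addn0; move: hb; rewrite !inE => /orP[]/eqP->.
    by rewrite u0E -!catA => /occurs_cat[].
  by rewrite v0E -!catA => /occurs_cat[].
move=> /occurs_cat[_ /IH]; rewrite -addnA.
suff -> : size b = L by rewrite mulSn; apply.
by move: hb; rewrite !inE => /orP[]/eqP->; rewrite ?size_v0.
Qed.

Lemma dvdn_size_uv k :
  (size (u 0) %| size (u k))%N /\ (size (u 0) %| size (v k))%N.
Proof.
elim: k => [|[|k] [hu hv]]; first by split; rewrite ?size_v0 dvdnn.
  rewrite u1E v1E; move: (u 0) (v 0) hu hv => a b hu hv.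
  by rewrite !size_cat; split; rewrite !(dvdn_addr, hu, hv).
rewrite uSSE vSSE; move: (u k.+1) (v k.+1) (size _) hu hv => a b L hu hv.
by rewrite !size_cat; split; do ![apply: dvdn_add => //].
Qed.

(** In [u k.+2] the third block is again [u k.+1]; it starts at [size (u k.+1) + size (v k.+1)], and
    both lengths are multiples of [size (u 0)]. *)
Lemma z_recurrent k :
  exists2 j, (0 < j)%N & occurs z (j * size (u 0)) (u k.+1).
Proof.
have [hu hv] := dvdn_size_uv k.+1.
have h : (size (u 0) %| size (u k.+1) + size (v k.+1))%N by exact: dvdn_add.
exists ((size (u k.+1) + size (v k.+1)) %/ size (u 0))%N.
  rewrite divn_gt0 ?(size_u_gt w t 0) //; apply: dvdn_leq => //.
  by have := size_u_gt w t k.+1; lia.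
rewrite divnK //.
have := z_u k.+2; rewrite uSSE catA => /occurs_cat[_ /occurs_cat[]].
by rewrite size_cat.
Qed.

Lemma u0_returns {x q} : occurs x q (u 0) ->
  [/\ occurs x q w, occurs x (q + (size w + t)) w &
      occurs x (q + ((size w + t) + (size w + t).+1)) w].
Proof.
rewrite u0E => /occurs_cat[h0 /occurs_cat[_ /occurs_cat[h1]]].
move=> /occurs_cat[_ /occurs_cat[h2 _]]; split=> //.
  by move: h1; rewrite /zeros size_nseq; congr occurs; lia.
by move: h2; rewrite /zeros !size_nseq; congr occurs; lia.
Qed.

(** Both blocks of level [k.+1] start with [u k], so the next block boundary at or after [m] gives
    an occurrence, and it is at most one block length away. *)
Lemma z_syndetic k : exists R, forall m, exists2 p, (p <= R)%N &
  occurs z (m + p) (u k).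
Proof.
exists (size (u k.+1) + size (v k.+1))%N; set R := addn _ _ => m.
have [[bs hb eb] _] := uv_flatten k.+1 (m + R).
have hub : prefix (u k) (u k.+1).
  by case: (k) => [|l]; rewrite ?u1E ?uSSE prefix_prefix.
have hvb : prefix (u k) (v k.+1).
  by case: (k) => [|l]; rewrite ?v1E ?vSSE prefix_prefix.
have sz : (m + R < size (flatten bs))%N.
  by rewrite -eb; apply: leq_trans (size_u_gt w t _); lia.
have := z_u (m + R + k.+1); rewrite {}eb.
suff H i : occurs z i (flatten bs) ->
    exists2 p, (p <= R)%N & occurs z (i + (m + p)) (u k) by exact: H.
have pre (b : seq bool) j : b \in [:: u k.+1; v k.+1] ->
    occurs z j b -> occurs z j (u k).
  rewrite !inE => /orP[]/eqP->; [move: hub|move: hvb] => /prefixP[r ->];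
    by move=> /occurs_cat[].
have szR (b : seq bool) : b \in [:: u k.+1; v k.+1] -> (size b <= R)%N.
  by rewrite !inE => /orP[]/eqP->; rewrite ?leq_addr ?leq_addl.
elim: bs m i hb sz => [|b bs IH] m i //= /andP[hb hbs] sz /occurs_cat[ob obs].
have [->|m0] := posnP m; first by exists 0%N; rewrite ?addn0 //; exact: pre ob.
have [bm|mb] := leqP (size b) m.
  have [] := IH (m - size b)%N _ hbs _ obs.
    by move: sz; rewrite size_cat; lia.
  by move=> p pR h; exists p => //; move: h; congr occurs; lia.
(* Here [m] falls strictly inside [b], so the occurrence comes from the next block; that one exists
   because the list is longer than [m + R]. *)
case: bs {IH} hbs sz obs => [|c bs] /=.
  by rewrite cats0; have := szR _ hb; lia.
move=> /andP[hc _] _ /occurs_cat[oc _]; exists (size b - m)%N.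
  by have := szR _ hb; lia.
by move: (pre _ _ hc oc); congr occurs; lia.
Qed.

End Substitution.

(** * Orbit closures in terms of words, and minimality of the closure of the orbit of [z] *)

Lemma orbit_closureP x y : closure (forward_orbit shift x) y <->
  forall K, exists m, occurs x m (mkseq y K).
Proof.
split=> [/closure_cylinderP h K|h].
  have [_ [m _ <-] hm] := h K; exists m => i; rewrite size_mkseq => iK.
  by rewrite nth_mkseq // -iter_shift hm.
apply/closure_cylinderP => K; have [m hm] := h K.
exists (iter m shift x); first by exists m.
by move=> i iK; rewrite iter_shift hm ?size_mkseq ?nth_mkseq.
Qed.

Lemma occurs_orbit_closure {x y p c} :
  closure (forward_orbit shift x) y -> occurs y p c -> exists m, occurs x m c.
Proof.
move=> /orbit_closureP/(_ (p + size c)%N)[m hm] hc; exists (m + p)%N => i ic.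
by rewrite -addnA hm ?size_mkseq ?nth_mkseq ?hc // ltn_add2l.
Qed.

(** A word of [y] lies in some [u_ w t k], which returns in [z_ w t] within a bounded distance [r].
    Hence every window of length [r + size (u_ w t k)] contains it, in particular the initial window
    of [x]. *)
Lemma z_minimal w t x y :
  closure (forward_orbit shift (z_ w t)) x ->
  closure (forward_orbit shift (z_ w t)) y ->
  closure (forward_orbit shift x) y.
Proof.
move=> hx /orbit_closureP hy; apply/orbit_closureP => K.
have [m hm] := hy K.
have /infixP[pre [post e]] := occurs_z_infix _ _ hm.
rewrite size_mkseq in e.
have [r hr] := z_syndetic w t (m + K)%N.
set N := (r + size (u_ w t (m + K)))%N.
have /orbit_closureP/(_ N)[q hq] := hx.
have [p pr hp] := hr q.
exists (p + size pre)%N; apply: (@occurs_infix _ _ _ _ post); rewrite -e.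
apply: occurs_eq hp => i hi.
have iN : (p + i < N)%N by rewrite /N; lia.
by rewrite -addnA hq ?size_mkseq ?nth_mkseq.
Qed.

(** * Words separated by long runs of zeros *)

(** Free zeros are allowed between the words of [S], which makes the class stable under
    concatenation and under the substitution. *)
Inductive gapped (G : nat) (S : seq bool -> Prop) : seq bool -> Prop :=
| gapped_nil : gapped G S [::]
| gapped_zero c : gapped G S c -> gapped G S (false :: c)
| gapped_word v g c : S v -> (G <= g)%N -> gapped G S c ->
    gapped G S (v ++ zeros g ++ c).

Lemma gapped_cat {G S a b} : gapped G S a -> gapped G S b -> gapped G S (a ++ b).
Proof.
elim=> [//|c _ IH /IH|v g c Sv Gg _ IH /IH h]; first exact: gapped_zero.
by rewrite -!catA; exact: gapped_word.
Qed.

Lemma gapped_zeros G S g : gapped G S (zeros g).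
Proof. by elim: g => [|g IH]; [exact: gapped_nil|exact: gapped_zero]. Qed.

Lemma prefix_cat_cases {T : eqType} {c a b : seq T} : prefix c (a ++ b) ->
  prefix c a \/ exists2 d, c = a ++ d & prefix d b.
Proof.
elim: a c => [|x a IH] [|y c] /=; try by [left|right; exists c|right; exists (y :: c)].
move=> /andP[/eqP-> /IH[h|[d -> h]]]; first by left; rewrite eqxx.
by right; exists d.
Qed.

Lemma infix_cat_cases {T : eqType} {c a b : seq T} : infix c (a ++ b) ->
  infix c a \/ infix c b \/ exists d e, [/\ c = d ++ e, suffix d a & prefix e b].
Proof.
elim: a => [|x a IH]; first by right; left.
rewrite cat_cons infix_consl => /orP[].
  rewrite -cat_cons => /prefix_cat_cases[h|[d -> h]]; first by left; exact: prefixW.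
  by right; right; exists (x :: a), d; split=> //; exact: suffix_refl.
move=> /IH[h|[h|[d [e [-> h1 h2]]]]].
- by left; rewrite infix_consl h orbT.
- by right; left.
right; right; exists d, e; split=> //.
by move: h1 => /suffixP[f ->]; rewrite -cat_cons suffix_suffix.
Qed.

Lemma subset_zeros {d g} : {subset d <= zeros g} -> d = zeros (size d).
Proof.
move=> h; apply/all_pred1P; apply/allP => b /h.
by rewrite mem_nseq => /andP[].
Qed.

(** Without [G] consecutive zeros, [c] cannot cross a complete gap, so it meets at most one word of
    [S]; the rest of it lies in the neighbouring zeros. *)
Lemma gapped_infix {G S W c} : gapped G S W -> infix c W ->
  ~~ infix (zeros G) c ->
  exists p q u, c = zeros p ++ u ++ zeros q /\
    (u = [::] \/ exists2 v, S v & infix u v).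
Proof.
move=> hW; elim: hW c => [|W' _ IH|v g W' Sv Gg _ IH] c.
- by rewrite infixs0 => /eqP-> _; exists 0%N, 0%N, [::]; split=> //; left.
- rewrite infix_consl => /orP[|/IH//].
  case: c => [|x c] /=; first by move=> _ _; exists 0%N, 0%N, [::]; split=> //; left.
  move=> /andP[/eqP-> /prefixW/IH h] nz.
  have /h[p [q [u [-> hu]]]] : ~~ infix (zeros G) c.
    by apply: contraNN nz => h'; apply: (@infix_catl _ _ _ [:: false]) h'.
  by exists p.+1, q, u.
have zsub k d : zeros k = d -> (G <= k)%N -> infix (zeros G) d.
  move=> <- Gk; apply/infixP; exists [::], (zeros (k - G)).
  by rewrite /= /zeros -nseqD subnKC.
have cin a b d : infix (zeros G) b -> infix (zeros G) (a ++ b ++ d).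
  move=> /infixP[x [y ->]]; apply/infixP; exists (a ++ x), (y ++ d).
  by rewrite !catA.
move=> /infix_cat_cases[h _|[h nz|[d [e [-> /suffixP[f hf] he]]] nz]].
- exists 0%N, 0%N, c; split; first by rewrite /= cats0.
  by right; exists v.
- case: (infix_cat_cases h) => [h'|[/IH/(_ nz)//|]].
    exists (size c), 0%N, [::]; split; last by left.
    by rewrite !cats0; exact: subset_zeros (mem_infix h').
  move=> [d [e [hc /suffixP[f hf] he]]].
  have hd : d = zeros (size d).
    by apply: (@subset_zeros _ g) => b bd; rewrite hf mem_cat bd orbT.
  have nze : ~~ infix (zeros G) e.
    by apply: contraNN nz => h'; rewrite hc -(cats0 e); exact: cin.
  have [p [q [u [ee hu]]]] := IH _ (prefixW he) nze.
  exists (size d + p)%N, q, u; split=> //.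
  by rewrite hc {1}hd ee /zeros nseqD -!catA.
case: (prefix_cat_cases he) => [h|[e' he' hpre]].
  exists 0%N, (size e), d; split.
    by rewrite /=; congr cat; exact: subset_zeros (mem_infix (prefixW h)).
  by right; exists v => //; rewrite hf suffix_infix.
(* Here [c] starts in [v] and runs beyond the gap, so it would contain all of its [g >= G] zeros. *)
have : infix (zeros G) (d ++ e) by rewrite he'; apply: cin; exact: zsub Gg.
by rewrite (negbTE nz).
Qed.

Lemma gapped_uv {G S w} t k : gapped G S w ->
  gapped G S (u_ w t k) /\ gapped G S (v_ w t k).
Proof.
move=> hw; elim: k => [|[|k] [hu hv]].
- by rewrite u0E v0E; split; do ?apply: gapped_cat => //; exact: gapped_zeros.
- rewrite u1E v1E; move: (u_ w t 0) (v_ w t 0) hu hv => a b ha hb.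
  by split; do ?apply: gapped_cat.
rewrite uSSE vSSE; move: (u_ w t k.+1) (v_ w t k.+1) hu hv => a b ha hb.
by split; do ?apply: gapped_cat.
Qed.

Lemma infix_zeros {m n} : (m <= n)%N -> infix (zeros m) (zeros n).
Proof.
by move=> mn; rewrite -(subnKC mn) /zeros nseqD; exact: prefix_infix.
Qed.

Lemma iter_stable {T : Type} {f : T -> T} {N : set T} n x :
  f @` N `<=` N -> N x -> N (iter n f x).
Proof. by move=> h Nx; elim: n => //= n IH; apply: h; exists (iter n f x). Qed.

(** * A bound for the Hausdorff distance, and auxiliary facts *)

Section Hausdorff.
Local Open Scope ring_scope.

(** Nonnegativity bounds the distance sets below, so each infimum is at most any member;
    nonemptiness makes an upper bound of the values a bound of their supremum. *)
Lemma hausdorff_dist_le {R : realType} {T : Type} (d : T -> T -> R) A B r :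
  (forall x y, 0 <= d x y) -> A !=set0 -> B !=set0 ->
  (forall a, A a -> exists2 b, B b & d a b <= r) ->
  (forall b, B b -> exists2 a, A a & d a b <= r) ->
  hausdorff_dist d A B <= r.
Proof.
move=> d0 A0 B0 hA hB; rewrite /hausdorff_dist ge_max; apply/andP; split.
  apply: ge_sup; first exact: image_nonempty.
  move=> _ [a Aa <-]; have [b Bb ab] := hA _ Aa; apply: le_trans ab.
  by apply: ge_inf; [exists 0 => _ [c _ <-]|exists b].
apply: ge_sup; first exact: image_nonempty.
move=> _ [b Bb <-]; have [a Aa ab] := hB _ Bb; apply: le_trans ab.
by apply: ge_inf; [exists 0 => _ [c _ <-]|exists a].
Qed.

End Hausdorff.

Lemma unbounded_infinite (A : set nat) :
  (forall N, exists2 n, (N <= n)%N & A n) -> infinite_set A.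
Proof.
move=> h /finite_seqP[s As]; have [n hn] := h (\max_(i <- s) i).+1.
rewrite As /= => ns; have := @leq_bigmax_seq _ s xpredT id n ns isT.
by rewrite leqNgt hn.
Qed.

Lemma infix_occurs {c W : seq bool} : infix c W ->
  exists2 p, (p <= size W)%N & forall x q, occurs x q W -> occurs x (q + p) c.
Proof.
move=> /infixP[pre [post ->]]; exists (size pre); first by rewrite size_cat leq_addr.
by move=> x q; exact: occurs_infix.
Qed.

(** * The factors of the constructed subshift *)

(** The choices of [t] and of the enumerations, made at each stage, become functions of [n]; their
    values at 0 are arbitrary. *)
Definition is_bbX_data (w : nat -> seq bool) (t : nat -> nat)
    (e : nat -> seq (seq bool)) (M : nat -> set cantor_space) :=
  (forall n, (1 <= n)%N ->
     M n = closure (forward_orbit shift (z_ (w n) (t n)))) /\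
  (forall n, (1 <= n)%N ->
     (forall v, v \in e n <->
        language n (\bigcup_(i in [set i | (1 <= i <= n)%N]) M i) v) /\
     w n.+1 = flatten [seq v ++ zeros (n * 9 ^ n) | v <- e n]).

Lemma construction_data R w M : @is_construction R w M ->
  exists t e, is_bbX_data w t e M.
Proof.
move=> [_ hX he].
have ht n : exists t, (1 <= n)%N ->
    M n = closure (forward_orbit shift (z_ (w n) t)).
  have [/hX[t _ ->]|n0] := boolP (1 <= n)%N; first by exists t.
  by exists 0%N.
have hE n : exists en : seq (seq bool), (1 <= n)%N -> (forall v, v \in en <->
        language n (\bigcup_(i in [set i | (1 <= i <= n)%N]) M i) v) /\
     w n.+1 = flatten [seq v ++ zeros (n * 9 ^ n) | v <- en].
  have [/he[en [_ h1 h2]]|n0] := boolP (1 <= n)%N; first by exists en.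
  by exists [::].
have [t ht'] := choice ht; have [e he'] := choice hE.
by exists t, e; split.
Qed.

Section Construction.
Context {w : nat -> seq bool} {t : nat -> nat} {e : nat -> seq (seq bool)}.
Context {M : nat -> set cantor_space} (D : is_bbX_data w t e M).

Local Notation z n := (z_ (w n) (t n)).
Definition factor n c := exists p, occurs (z_ (w n) (t n)) p c.
Definition bb_factor c := exists2 n, (1 <= n)%N & factor n c.

Lemma factor_infix {n c d} : factor n d -> infix c d -> factor n c.
Proof. by move=> [p h] /infix_occurs[q _ hq]; exists (p + q)%N; exact: hq. Qed.

Lemma M_z n : (1 <= n)%N -> M n (z n).
Proof.
move=> n1; rewrite D.1 //; apply: subset_closure; by exists 0%N.
Qed.

Lemma M_occurs {n x p c} : (1 <= n)%N -> M n x -> occurs x p c -> factor n c.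
Proof. by move=> n1; rewrite D.1 //; exact: occurs_orbit_closure. Qed.

Lemma M_factor {n x} : (1 <= n)%N -> (forall K, factor n (mkseq x K)) -> M n x.
Proof. by move=> n1; rewrite D.1 // => h; apply/orbit_closureP. Qed.

Lemma language_factor {n v} : (1 <= n)%N ->
  language n (\bigcup_(i in [set i | (1 <= i <= n)%N]) M i) v <->
  size v = n /\ exists2 i, (1 <= i <= n)%N & factor i v.
Proof.
move=> n1; split.
  move=> [x [i /= hi Mx] [m ->]]; rewrite size_mkseq; split=> //.
  by exists i => //; apply: M_occurs Mx (occurs_mkseq _ _ _); lia.
move=> [sv [i hi [p hp]]]; exists (z i); first by exists i => //; apply: M_z; lia.
by exists p; rewrite -sv; exact: mkseq_occurs.
Qed.

(** The enumeration lists words of length exactly [n], so [c] is first extended to the right, inside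
    [z i], to that length. *)
Lemma infix_w n i c : (1 <= i <= n)%N -> (size c <= n)%N -> factor i c ->
  infix c (w n.+1).
Proof.
move=> hi cn [p hp].
have n1 : (1 <= n)%N by lia.
pose v := mkseq (fun j => z i (p + j)%N) n.
have ve : v \in e n.
  apply/(D.2 _ n1).1/language_factor => //; rewrite size_mkseq; split=> //.
  by exists i => //; exists p; exact: occurs_mkseq.
have cv : infix c v.
  have -> : v = c ++ drop (size c) v; last by rewrite infix_catr // infix_refl.
  rewrite -{1}(cat_take_drop (size c) v); congr cat.
  rewrite (mkseq_occurs hp) size_mkseq /v.
  apply: (@eq_from_nth _ false); rewrite size_take_min !size_mkseq; first by lia.
  by move=> j hj; rewrite nth_take ?nth_mkseq; lia.
apply: (infix_trans cv); rewrite (D.2 _ n1).2.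
elim: (e n) ve => //= a s IH; rewrite inE => /orP[/eqP<-|/IH h].
  by rewrite -catA infix_catr // infix_refl.
exact: infix_catl.
Qed.

Lemma infix_w_ev {c} : bb_factor c ->
  exists N, forall n, (N <= n)%N -> infix c (w n.+1).
Proof.
move=> [i i1 hc]; exists (maxn i (size c)) => n hn.
by apply: infix_w hc; lia.
Qed.

Lemma bbX_factor {x p c} : bbX M x -> occurs x p c -> bb_factor c.
Proof.
move=> /closure_cylinderP/(_ (p + size c)%N)[y [n n1 My] hy] hc.
exists n => //; apply: (@M_occurs n y p c) => // i hi.
by rewrite hy ?hc //; lia.
Qed.

Lemma iter_shift_bbX n x : bbX M x -> bbX M (iter n shift x).
Proof.
move=> Xx; apply/closure_cylinderP => K.
have [i i1 [p hp]] : bb_factor (mkseq (fun j => x (n + j)%N) K).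
  exact: bbX_factor Xx (occurs_mkseq _ _ _).
exists (iter p shift (z i)).
  by exists i => //; rewrite D.1 //; apply: subset_closure; exists p.
by move=> j jK; rewrite !iter_shift hp ?size_mkseq ?nth_mkseq.
Qed.

Lemma M_bbX {n} : (1 <= n)%N -> M n `<=` bbX M.
Proof. by move=> n1 x Mx; apply: subset_closure; exists n. Qed.

Lemma shift_z_bbX n p : (1 <= n)%N -> bbX M (iter p shift (z n)).
Proof.
move=> n1; apply: (@M_bbX n) => //; rewrite D.1 //.
by apply: subset_closure; exists p.
Qed.

Lemma u0_bb_factor {n} : (1 <= n)%N -> bb_factor (u_ (w n) (t n) 0).
Proof. by move=> n1; exists n => //; exists 0%N; exact: z_u. Qed.

Lemma w_bb_factor {n} : (1 <= n)%N -> bb_factor (w n).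
Proof.
move=> n1; exists n => //; exists 0%N.
by have [] := u0_returns _ _ (z_u (w n) (t n) 0).
Qed.

(** * Weak mixing *)

(* A gap m between a and c inside w n reappears as the gaps m + s + t and
   m + s + t + 1 between a and c in u_0, whose copies of w n lie s + t and
   s + t + 1 apart; so each passage to the next level lengthens an interval of
   gaps by one. *)
Lemma gaps_thick {a c} r : bb_factor a -> bb_factor c ->
  exists m N, forall n, (N <= n)%N -> forall j, (j <= r)%N ->
    exists p, forall x q, occurs x q (w n.+1) ->
      occurs x (q + p) a /\ occurs x (q + p + (m + j)) c.
Proof.
move=> /infix_w_ev[Na ha] /infix_w_ev[Nc hc].
elim: r => [|r [m [N hN]]].
  pose n0 := maxn Na Nc.
  have /infix_w_ev[N hN] := u0_bb_factor (ltn0Sn n0).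
  have [pa lepa opa] := infix_occurs (ha n0 (leq_maxl _ _)).
  have [pc lepc opc] := infix_occurs (hc n0 (leq_maxr _ _)).
  (* The truncated subtraction is exact, since [pa] is at most [size (w n0.+1)]. *)
  exists (size (w n0.+1) + t n0.+1 + pc - pa)%N, N => n /hN/infix_occurs[p _ op].
  move=> j; rewrite leqn0 => /eqP->; exists (p + pa)%N.
  move=> x q /op/(u0_returns _ _)[h0 h1 _].
  split; first by rewrite addnA; exact: opa.
  by have := opc _ _ h1; congr occurs; lia.
have /infix_w_ev[N' hN'] := u0_bb_factor (ltn0Sn N).
exists (size (w N.+1) + t N.+1 + m)%N, N' => n /hN'/infix_occurs[p _ op] j jr.
have [jr'|rj] := leqP j r.
  have [pj hpj] := hN N (leqnn N) j jr'.
  exists (p + pj)%N => x q /op/(u0_returns _ _)[/hpj[h0 _] /hpj[_ h1] _].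
  by split; [move: h0|move: h1]; congr occurs; lia.
have [pj hpj] := hN N (leqnn N) r (leqnn r).
exists (p + (size (w N.+1) + t N.+1 + pj))%N.
move=> x q /op/(u0_returns _ _)[_ /hpj[h1 _] /hpj[_ h2]].
by split; [move: h1|move: h2]; congr occurs; lia.
Qed.

Lemma bbX_weakly_mixing : weakly_mixing shift (bbX M).
Proof.
move=> U V oU oV [[x1 x2] [[/= X1 X2] Ux]] [[y1 y2] [[/= Y1 Y2] Vy]].
have boxP (W : set (cantor_space * cantor_space)) p1 p2 : open W -> W (p1, p2) ->
    exists K, cylinder p1 K `*` cylinder p2 K `<=` W.
  move=> oW Wp; have : nbhs (p1, p2) W by exact: open_nbhs_nbhs.
  move=> [[A B] /= [/cylinder_sub_nbhs[K hK] /cylinder_sub_nbhs[L hL]] hAB].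
  exists (maxn K L) => -[y z] /= [hy hz]; apply: hAB; split=> /=.
    by apply: hK => i ik; apply: hy; lia.
  by apply: hL => i ik; apply: hz; lia.
have [K hK] := boxP _ _ _ oU Ux; have [L hL] := boxP _ _ _ oV Vy.
have fac y J : bbX M y -> bb_factor (mkseq y J).
  by move=> /bbX_factor; apply; exact: (occurs_mkseq y 0).
have [/(_ x1 K X1)/infix_w_ev[N1 h1] /(_ x2 K X2)/infix_w_ev[N2 h2]] := (fac, fac).
have [/(_ y1 L Y1)/infix_w_ev[N3 h3] /(_ y2 L Y2)/infix_w_ev[N4 h4]] := (fac, fac).
pose n0 := (N1 + N2 + N3 + N4)%N.
have [pa _ oa] := infix_occurs (h1 n0 ltac:(lia)).
have [pb _ ob] := infix_occurs (h2 n0 ltac:(lia)).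
have [pc _ oc] := infix_occurs (h3 n0 ltac:(lia)).
have [pd _ od] := infix_occurs (h4 n0 ltac:(lia)).
apply: unbounded_infinite => N.
have wf := w_bb_factor (ltn0Sn n0).
(* Copies of [w n0.+1] at gap [m + j] put the first pair of words at distance [m + j + pc - pa] and
   the second at [m + j + pd - pb]. Both equal [m + pc + pd + N] for [j = pa + pd + N] and
   [j = pb + pc + N] respectively, which fixes the range needed. *)
have [m [N' hN']] := gaps_thick (pa + pb + pc + pd + N) wf wf.
exists (m + pc + pd + N)%N; first by lia.
have hz := (u0_returns _ _ (z_u (w N'.+1) (t N'.+1) 0)).
have hit pa' pc' a' c' j : (j <= pa + pb + pc + pd + N)%N ->
  (pa' + (m + pc + pd + N) = m + j + pc')%N ->
  (forall x q, occurs x q (w n0.+1) -> occurs x (q + pa') a') ->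
  (forall x q, occurs x q (w n0.+1) -> occurs x (q + pc') c') ->
  exists x, [/\ bbX M x, occurs x 0 a' & occurs x (m + pc + pd + N) c'].
  move=> hj ej ha' hc'; have [p hp] := hN' _ (leqnn _) j hj.
  have [h0 _ _] := hz; have [hp1 hp2] := hp _ _ h0.
  exists (iter (p + pa') shift (z_ (w N'.+1) (t N'.+1))).
  split; first exact: shift_z_bbX.
    by apply: occurs_eq (ha' _ _ hp1) => i _; rewrite iter_shift; congr z_; lia.
  by apply: occurs_eq (hc' _ _ hp2) => i _; rewrite iter_shift; congr z_; lia.
have [x [Xx xa xc]] := hit pa pc _ _ (pa + pd + N)%N ltac:(lia) ltac:(lia) oa oc.
have [y [Xy yb yd]] := hit pb pd _ _ (pb + pc + N)%N ltac:(lia) ltac:(lia) ob od.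
have cyl u v J p : occurs u p (mkseq v J) -> cylinder v J (iter p shift u).
  by move=> h i iJ; rewrite iter_shift h ?size_mkseq ?nth_mkseq.
have iterE n (u v : cantor_space) :
    iter n (fun p => (shift p.1, shift p.2)) (u, v) = (iter n shift u, iter n shift v).
  by elim: n => //= n ->.
exists (x, y); split; first split => //.
  by apply: hK; split; [exact: (cyl _ _ _ 0%N xa)|exact: (cyl _ _ _ 0%N yb)].
rewrite /preimage /= iterE; split.
  by split; exact: iter_shift_bbX.
by apply: hL; split; exact: cyl.
Qed.

(** * Minimal sets *)

(** Strong induction on [i]. For [i = n.+1 > B.+2] the gaps in [w n.+1] have length
    [n * 9 ^ n >= B.+1], so up to zeros at the ends [c] lies in one enumerated word, a factor of
    some [M j] with [j <= n]. *)
Lemma factor_trim {B i c} : (1 <= i)%N -> factor i c ->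
  ~~ infix (zeros B.+1) c ->
  exists p q u j, [/\ c = zeros p ++ u ++ zeros q, (1 <= j <= B.+2)%N & factor j u].
Proof.
elim/ltn_ind: i c => i IH c i1 hc nz.
have [iB|Bi] := leqP i B.+2.
  by exists 0%N, 0%N, c, i; rewrite /= cats0; split=> //; lia.
case: i => [//|n] in IH i1 hc Bi *.
have n1 : (1 <= n)%N by lia.
pose G := (n * 9 ^ n)%N.
have nG : (B.+1 <= G)%N.
  by apply: leq_trans (leq_pmulr n _); rewrite ?expn_gt0 //; lia.
have gw : gapped G (fun v => v \in e n) (w n.+1).
  rewrite (D.2 _ n1).2 -/G.
  suff H s : {subset s <= e n} -> gapped G (fun v => v \in e n)
    (flatten [seq v ++ zeros G | v <- s]) by exact: H.
  elim: s => [_|v s IHs sub] /=; first exact: gapped_nil.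
  rewrite -catA; apply: gapped_word => //; first by apply: sub; rewrite inE eqxx.
  by apply: IHs => x xs; apply: sub; rewrite inE xs orbT.
have [p0 hp0] := hc; have hin := occurs_z_infix _ _ hp0.
have nzG : ~~ infix (zeros G) c.
  by apply: contraNN nz; apply: infix_trans (infix_zeros nG).
have [p [q [u [ec hu]]]] := gapped_infix (gapped_uv (t n.+1) _ gw).1 hin nzG.
case: hu => [u0|[v ve uv]].
  exists p, q, [::], 1%N; split=> //; first by rewrite ec u0.
  by exists 0%N.
have [_ [j jn hj]] := (language_factor n1).1 (((D.2 _ n1).1 v).1 ve).
have nzu : ~~ infix (zeros B.+1) u.
  by apply: contraNN nz; rewrite ec => h; apply: infix_catl; exact: infix_catr.
have [|||p' [q' [u' [i' [eu hi' hu']]]]] := IH j _ u _ _ nzu; try by lia.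
  exact: factor_infix hj uv.
exists (p + p')%N, (q' + q)%N, u', i'; split=> //.
by rewrite ec eu /zeros !nseqD -!catA.
Qed.

Lemma M_minimal {n x y} : (1 <= n)%N -> M n x -> M n y ->
  closure (forward_orbit shift x) y.
Proof. by move=> n1; rewrite D.1 //; exact: z_minimal. Qed.

Lemma minimal_set_bbX (N : set cantor_space) : minimal_set shift (bbX M) N ->
  N = [set zero_seq] \/ exists2 n, (1 <= n)%N & N = M n.
Proof.
move=> [NX [x Nx] cN fN orbN].
have Nclos y : N y -> closure (forward_orbit shift y) `<=` N.
  move=> Ny; apply: subset_trans cN; apply: closureS => _ [n _ <-].
  exact: iter_stable.
have [h|/existsNP[B hB]] := pselect (forall B, exists p, occurs x p (zeros B)).
  have N0 : N zero_seq.
    apply: (Nclos x) => //; apply/orbit_closureP => K; have [p hp] := h K.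
    exists p => l; rewrite size_mkseq => lK.
    by rewrite nth_mkseq // hp ?size_nseq // nth_nseq lK.
  left; apply/seteqP; split=> [y Ny|_ -> //].
  apply/funext => i; have /orbit_closureP/(_ i.+1)[m hm] := orbN _ N0 _ Ny.
  by have := hm i; rewrite size_mkseq nth_mkseq // => /(_ (ltnSn i)) <-.
right; set y := iter B.+1 shift x.
have Ny : N y by exact: iter_stable.
have trim K : exists2 i, (1 <= i <= B.+2)%N & factor i (mkseq y K).
  (* The margins [B.+1] exceed the at most [B] zeros trimmed at either end, so the prefix of [y]
     survives in the trimmed word. *)
  set c := mkseq x (B.+1 + K + B.+1).
  have oc : occurs x 0 c by exact: occurs_mkseq.
  have nz : ~~ infix (zeros B.+1) c.
    apply/negP => h; apply: hB.
    have /infix_occurs[p _ hp] := infix_trans (infix_zeros (leqnSn B)) h.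
    by exists (0 + p)%N; exact: hp.
  have [i i1 hi] := bbX_factor (NX _ Nx) oc.
  have [p [q [u [j [ec hj [r hr]]]]]] := factor_trim i1 hi nz.
  have pB : (p <= B)%N.
    rewrite leqNgt; apply: contraNN nz => /infix_zeros h.
    by rewrite ec; exact: infix_catr.
  have qB : (q <= B)%N.
    rewrite leqNgt; apply: contraNN nz => /infix_zeros h.
    by rewrite ec; do 2 apply: infix_catl.
  have sc : (p + size u + q = B.+1 + K + B.+1)%N.
    have := congr1 size ec; rewrite /c !size_cat /zeros !size_nseq size_mkseq; lia.
  exists j => //; exists (r + (B.+1 - p))%N => l; rewrite size_mkseq => lK.
  rewrite -addnA hr; last by lia.
  rewrite nth_mkseq // /y iter_shift.
  rewrite -(nth_mkseq false x (n := B.+1 + K + B.+1)); last by lia.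
  rewrite -/c ec nth_cat /zeros size_nseq ifF; last by lia.
  by rewrite nth_cat ifT; [congr nth|]; lia.
have [i [i1 hi]] : exists i, (1 <= i)%N /\ forall K, factor i (mkseq y K).
  (* Pigeonhole: otherwise each [i >= 1] fails at some length [k i], while the prefix of [y] of the
     maximal such length over [i <= B.+2] is a factor of one of these [M i]. *)
  apply: contrapT => /forallNP nh.
  have bad i : exists K, (1 <= i)%N -> ~ factor i (mkseq y K).
    have [i1|] := boolP (1 <= i)%N; last by exists 0%N.
    have /not_andP[|/existsNP[K hK]] := nh i; first by rewrite i1.
    by exists K.
  have [k hk] := choice bad.
  have [i /andP[i1 iB]] := trim (\max_(i < B.+3) k i).
  apply: contra_not (hk i i1) => h; apply: factor_infix h _.
  set L := bigop _ _ _.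
  have kL : (k i <= L)%N by exact: (leq_bigmax (Ordinal (iB : (i < B.+3)%N))).
  apply/infixP; exists [::], (mkseq (fun j => y (k i + j)%N) (L - k i)).
  rewrite /= /mkseq -{1}(subnKC kL) iotaD map_cat; congr cat.
  by rewrite add0n -{1}(addn0 (k i)) iotaDl -map_comp.
have My : M i y by exact: (M_factor i1 hi).
exists i => //; apply/seteqP; split=> u.
  move=> Nu; have yu := orbN _ Ny _ Nu; apply: (M_factor) => // K.
  have [p hp] := occurs_orbit_closure yu (occurs_mkseq u 0 K).
  exact: (M_occurs i1 My hp).
by move=> Mu; apply: (Nclos y) => //; exact: M_minimal My Mu.
Qed.

(** * Dense periodic points in the hyperspace *)

(** The set is the closure of the points of the orbit of [z] at times [p + j * L], where [p] locates
    the prefix of [x] inside [w N.+1], which occurs at every multiple of [L]. *)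
Lemma small_periodic_set x K : bbX M x ->
  exists A : set cantor_space, [/\ closed A, A !=set0, A `<=` bbX M,
    A `<=` cylinder x K & exists2 L, (0 < L)%N & iter L shift @` A = A].
Proof.
move=> Xx; have [N hN] := infix_w_ev (bbX_factor Xx (occurs_mkseq x 0 K)).
have [p _ hp] := infix_occurs (hN N (leqnn N)).
set z := z_ (w N.+1) (t N.+1).
set L := size (u_ (w N.+1) (t N.+1) 0).
pose O := range (fun j => iter (p + j * L) shift z).
have clO := @closed_closure cantor_space O.
exists (closure O); split => //.
- exists (iter (p + 0 * L) shift z); apply: subset_closure; by exists 0%N.
- apply: (subset_trans _ (@closed_closure _ _)); apply: closureS => _ [j _ <-].
  exact: (shift_z_bbX).
- move=> y /closure_cylinderP/(_ K)[_ [j _ <-] hj] i iK.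
  rewrite -hj // iter_shift.
  have := hp _ _ (z_periodic (w N.+1) (t N.+1) j) i.
  by rewrite size_mkseq nth_mkseq // => <- //; congr z_; lia.
exists L; first exact: (size_u_gt (w N.+1) (t N.+1) 0).
apply/seteqP; split.
  move=> _ [y /closure_cylinderP hy <-]; apply/closure_cylinderP => k.
  have [_ [j _ <-] hj] := hy (L + k)%N.
  exists (iter (p + j.+1 * L) shift z); first by exists j.+1.
  move=> i ik; rewrite !iter_shift -hj; last by rewrite ltn_add2l.
  by rewrite iter_shift; congr z; lia.
have step j : (iter L shift @` closure O) (iter (p + j.+1 * L) shift z).
  exists (iter (p + j * L) shift z); first by apply: subset_closure; exists j.
  by rewrite -iterD; congr iter; lia.
apply: (subset_trans _ (closed_image_shift L clO)).
apply: closureS => _ [[|j] _ <-] //.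
apply: (closed_image_shift L clO); apply/closure_cylinderP => k.
(* Only the point with [j = 0] has no visible preimage. Since a long prefix of [z] recurs at a
   positive multiple of [L], it is a limit of later points, which lie in the closed image. *)
have [[//|j] _ hj] := z_recurrent (w N.+1) (t N.+1) (p + k).
rewrite -/z -/L in hj.
exists (iter (p + j.+1 * L) shift z); first exact: step.
move=> i ik; rewrite !iter_shift mul0n addn0 (addnC p) -addnA hj.
  by rewrite -z_prefix //; have := size_u_gt (w N.+1) (t N.+1) (p + k).+1; lia.
by have := size_u_gt (w N.+1) (t N.+1) (p + k).+1; lia.
Qed.

(** A finite union of the preceding sets, one per point of [s]; the product of the periods is a
    common period. *)
Lemma finite_union_periodic (K : cantor_space -> nat) (s : seq cantor_space) :
  (forall x, x \in s -> bbX M x) ->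
  exists Y : set cantor_space, [/\ closed Y, Y `<=` bbX M,
    (exists2 L, (0 < L)%N & iter L shift @` Y = Y),
    forall y, Y y -> exists2 x, x \in s & cylinder x (K x) y &
    forall x, x \in s -> exists2 y, Y y & cylinder x (K x) y].
Proof.
elim: s => [_|x s IH hs].
  exists set0; split=> //; first exact: closed0.
  by exists 1%N => //; rewrite image_set0.
have [|Y [cY YX [LY LY0 hY] Ys sY]] := IH.
  by move=> y ys; apply: hs; rewrite inE ys orbT.
have [|A [cA [a Aa] AX Ax [LA LA0 hA]]] := @small_periodic_set x (K x).
  by apply: hs; rewrite inE eqxx.
have iterM m L (B : set cantor_space) :
    iter L shift @` B = B -> iter (m * L) shift @` B = B.
  move=> h; elim: m => [|m IHm]; first by rewrite image_id.
  rewrite mulSn addnC -[RHS]IHm -[in RHS]h image_comp.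
  by apply: eq_imagel => y _ /=; rewrite -iterD.
exists (A `|` Y); split.
- exact: closedU.
- by move=> y [/AX|/YX].
- exists (LY * LA)%N; first by rewrite muln_gt0 LY0.
  by rewrite image_setU iterM // mulnC iterM.
- move=> y [/Ax h|/Ys[x' x's h]]; first by exists x; rewrite ?inE ?eqxx.
  by exists x'; rewrite // inE x's orbT.
- move=> x'; rewrite inE => /orP[/eqP->|/sY[y Yy h]].
    by exists a; [left|exact: Ax].
  by exists y => //; right.
Qed.

Local Open Scope ring_scope.

(** Compactness covers [A] by finitely many cylinders of [d]-radius [r / 4]. The periodic set built
    for their centres has points in all of them and none outside, so it is within [r / 2] of [A]. *)
Lemma hyperspace_dense_periodic {R : realType} (d : cantor_space -> cantor_space -> R) :
  compatible_metric d ->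
  dense_periodic_points (hausdorff_dist d) (hyperspace (bbX M))
    (fun A => shift @` A).
Proof.
move=> [d0 dC dD dnbhs] A [A0 cA AX] r r0.
have dpos x y : 0 <= d x y.
  by have := dD x y x; rewrite (dC y x) (d0 x x).2 //; lra.
have ballK x : exists K, cylinder x K `<=` [set y | d x y < r / 4].
  by apply: cylinder_sub_nbhs; apply/dnbhs; exists (r / 4) => //; lra.
have [K hK] := choice ballK.
have := closed_cantor_compact cA; rewrite compact_cover.
move=> /(_ cantor_space A (fun x => (cylinder x (K x))°)) [].
- by move=> x _; exact: open_interior.
- by move=> x Ax; exists x => //; exact: nbhs_cylinder.
move=> s sA As.
have [|Y [cY YX [L L0 hL] Ys sY]] := @finite_union_periodic K (finmap.enum_fset s).
  by move=> x /sA; rewrite inE => /AX.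
have Y0 : Y !=set0.
  have [a /As[x /= xs _]] := A0; have [y Yy _] := sY _ xs; by exists y.
exists Y; split.
- by [].
- by exists L => //; rewrite iter_image_shift.
apply: (@le_lt_trans _ _ (r / 2)); last by lra.
apply: hausdorff_dist_le => //.
  move=> a /As[x /= xs /interior_subset/hK/= xa].
  have [y Yy /hK/= xy] := sY _ xs; exists y => //.
  by have := dD a x y; rewrite (dC a x); lra.
move=> y /Ys[x xs /hK/= xy]; exists x; last by lra.
by have := sA _ xs; rewrite inE.
Qed.

End Construction.

Theorem theorem6p4 (R : realType) (w : nat -> seq bool)
    (M : nat -> set cantor_space) (HwM : is_construction R w M) :
  [/\ (forall N : set cantor_space, minimal_set shift (bbX M) N ->
         N = [set zero_seq] \/ (exists2 n, (1 <= n)%N & N = M n)),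
      weakly_mixing shift (bbX M) &
      (forall d : cantor_space -> cantor_space -> R, compatible_metric d ->
         dense_periodic_points (hausdorff_dist d) (hyperspace (bbX M))
           (fun A => shift @` A))].
Proof.
have [t [e D]] := construction_data R w M HwM.
split.
- exact: (minimal_set_bbX D).
- exact: (bbX_weakly_mixing D).
- by move=> d; exact: (hyperspace_dense_periodic D).
Qed.
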